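(* Let $\lambda\ge1$ be an integer. Any algorithm that is given an integer $\kappa$ and query access (in the general graph query model) to an $n$-vertex graph $G$ with $\kappa(G)=\kappa$, and that with probability at least $2/3$ produces a proper $(\kappa+\lambda)$-coloring of $G$, must make $\Omega(n^2/\lambda^2)$ queries.
   Context: In the general graph query model the algorithm knows the vertex set $[n]$ and accesses $G$ only via pair queries $\mathrm{Pair}(u,v)$ (returning whether $\{u,v\}\in E(G)$) and neighbor queries $\mathrm{Nbr}(u,j)$ (returning the $j$th neighbor of $u$ in a fixed ordering of its adjacency list, or $\bot$ if none). $\kappa(G)$ is the degeneracy of $G$: the least $k$ such that every induced subgraph has a vertex of degree at most $k$. *)

(* Defs.v *)
From HB Require Import structures.
From mathcomp Require Export all_boot all_order all_algebra.
From mathcomp Require Export all_classical all_reals all_analysis.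

Set Implicit Arguments.
Unset Strict Implicit.
Unset Printing Implicit Defensive.

(* A simple graph on [n] as a query algorithm accesses it, that is, together
   with an arbitrary (not necessarily sorted) ordering of each adjacency list. *)
Record query_graph (n : nat) := QueryGraph {
  adj : rel 'I_n;
  adj_sym : symmetric adj;
  adj_irr : irreflexive adj;
  adj_list : 'I_n -> seq 'I_n;
  adj_list_uniq : forall u, uniq (adj_list u);
  mem_adj_list : forall u v, (v \in adj_list u) = adj u v
}.

Definition induced_degree (n : nat) (G : query_graph n) (S : {set 'I_n})
    (v : 'I_n) : nat := #|[pred w in S | adj G v w]|.

Definition degenerate (n : nat) (G : query_graph n) (k : nat) : bool :=
  [forall S : {set 'I_n}, (S != finset.set0) ==>
     [exists v in S, induced_degree G S v <= k]].

Lemma degenerate_ex (n : nat) (G : query_graph n) :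
  exists k, degenerate G k.
Proof.
exists n; apply/forallP => S; apply/implyP => /finset.set0Pn[v vS].
apply/existsP; exists v; rewrite vS /=.
by rewrite -[X in _ <= X](card_ord n) max_card.
Qed.

Definition degeneracy (n : nat) (G : query_graph n) : nat :=
  ex_minn (degenerate_ex G).

Definition proper_coloring (n k : nat) (G : query_graph n)
    (c : {ffun 'I_n -> nat}) : Prop :=
  (forall v, c v < k) /\ (forall u v, adj G u v -> c u != c v).

(* Deterministic adaptive query algorithms: the continuation of a query
   receives its answer, and computation between queries is unrestricted. *)
Inductive query_tree (n : nat) (O : Type) : Type :=
| Output of O
| Pair of 'I_n & 'I_n & (bool -> query_tree n O)
| Nbr of 'I_n & nat & (option 'I_n -> query_tree n O).

(* [Nbr u j] is indexed from 0; the answer [None] stands for "no such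
   neighbor". *)
Fixpoint run (n : nat) (O : Type) (G : query_graph n) (t : query_tree n O) : O :=
  match t with
  | Output o => o
  | Pair u v k => run G (k (adj G u v))
  | Nbr u j k => run G (k (onth (adj_list G u) j))
  end.

Fixpoint num_queries (n : nat) (O : Type) (G : query_graph n)
    (t : query_tree n O) : nat :=
  match t with
  | Output _ => 0
  | Pair u v k => (num_queries G (k (adj G u v))).+1
  | Nbr u j k => (num_queries G (k (onth (adj_list G u) j))).+1
  end.

(* A randomized algorithm is a deterministic one chosen by a random seed in T.
   The measurability conditions only say that, on each input, the output and
   the number of queries are (discrete) random variables. *)
Record rand_query_alg (d : measure_display) (T : measurableType d) (n : nat)
    (O : Type) := RandQueryAlg {
  tree_of_seed :> T -> query_tree n O;
  measurable_run : forall (G : query_graph n) (B : set O),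
    measurable [set r : T | B (run G (tree_of_seed r))]%classic;
  measurable_num_queries : forall (G : query_graph n) (B : set nat),
    measurable [set r : T | B (num_queries G (tree_of_seed r))]%classic
}.

(* Main.v *)
Require Import Defs.
From mathcomp Require Import zify lra measurable_realfun.
Import Order.TTheory GRing.Theory Num.Theory.

Set Implicit Arguments.
Unset Strict Implicit.
Unset Printing Implicit Defensive.

(* Hide a missing block pair in a clique. Put n/(4 lambda) =: p blocks of lambda
   vertices in each of four parts; parts 0 and 1 form together a clique on
   2 lambda p vertices, parts 2 and 3 a complete bipartite graph. For a hidden
   pair (i, j) take block i of parts 0 and 3 and block j of parts 1 and 2, and
   exchange edges and non-edges along the 4-cycle 0-1-3-2 of these blocks. This
   preserves all degrees, so the lists change only in the slots of the switched
   pairs, and lowers the degeneracy to kappa = 2 lambda p - 1 - lambda. With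
   kappa + lambda = 2 lambda p - 1 colors some clique pair is monochromatic; it
   must have been switched, hence reveals (i, j). A query to the unswitched graph
   also concerns only one of the p^2 hidden pairs, so a deterministic algorithm
   with Q queries succeeds for at most Q + 1 of them. Averaging over the hidden
   pair gives (2/3) p^2 <= Q + 1. *)

(** * Algorithms on graphs with nearly equal answers *)

(** [s] collects the exceptional index of each of the first [Q] queries of [t] on [G0]; every other
    [G i] answers these alike. A run still unfinished then exceeds the query bound on [G i]. *)
Lemma query_indistinguishable (n : nat) (O : Type) (I : eqType)
    (G0 : query_graph n) (G : I -> query_graph n) :
  (forall u v, exists i0, forall i, i != i0 -> adj (G i) u v = adj G0 u v) ->
  (forall u j, exists i0, forall i, i != i0 ->
     onth (adj_list (G i) u) j = onth (adj_list G0 u) j) ->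
  forall (Q : nat) (t : query_tree n O), exists s : seq I, size s <= Q /\
    forall i, i \notin s -> num_queries (G i) t <= Q -> run (G i) t = run G0 t.
Proof.
move=> Gpair Gnbr; elim=> [|Q IHQ] [x|u v k|u j k].
- by exists [::].
- by exists [::].
- by exists [::].
- by exists [::].
- have [i0 i0P] := Gpair u v; have [s [sQ sP]] := IHQ (k (adj G0 u v)).
  exists (i0 :: s); split=> // i; rewrite inE negb_or => /andP[ii0 his] /=.
  by rewrite i0P// => /sP ->.
- have [i0 i0P] := Gnbr u j.
  have [s [sQ sP]] := IHQ (k (onth (adj_list G0 u) j)).
  exists (i0 :: s); split=> // i; rewrite inE negb_or => /andP[ii0 his] /=.
  by rewrite i0P// => /sP ->.
Qed.

(** * Counting tools *)

Lemma card_ord_injection (n k : nat) (A : {pred 'I_n}) (f : nat -> nat) :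
  (forall t, t < k -> f t < n) ->
  (forall t t', t < k -> t' < k -> f t = f t' -> t = t') ->
  (forall v : 'I_n, reflect (exists2 t, t < k & v = f t :> nat) (v \in A)) ->
  #|A| = k.
Proof.
move=> f_lt f_inj Af.
pose g (t : 'I_k) : 'I_n := Ordinal (f_lt t (ltn_ord t)).
have g_inj : injective g.
  move=> t t' /(congr1 val) /= ft; apply: val_inj.
  exact: f_inj (ltn_ord t) (ltn_ord t') ft.
rewrite -[RHS](card_ord k) -(card_codom g_inj); apply: eq_card => v.
apply/idP/idP => [/Af[t tk vE]|/codomP[t ->]].
  by apply/codomP; exists (Ordinal tk); apply: val_inj.
by apply/Af; exists (val t); first exact: ltn_ord.
Qed.

Lemma card_predD (T : finType) (A B : {pred T}) :
  B \subset A -> #|[predD A & B]| = #|A| - #|B|.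
Proof.
move=> /fintype.subsetP BA; rewrite -(cardID B A).
have -> : #|[predI A & B]| = #|B|; last by rewrite addKn.
by apply: eq_card => x; rewrite inE /= andb_idl// => /BA.
Qed.

(** * The switched graphs and their adjacency lists *)

Section SwitchedGraph.
Variables (n lam p : nat).
Hypotheses (lam_gt0 : 0 < lam) (p_gt1 : 1 < p).
Let m := lam * p.
Hypothesis m4n : 4 * m <= n.

Let p_gt0 : 0 < p. Proof. exact: ltnW. Qed.
Let m_gt0 : 0 < m. Proof. by rewrite muln_gt0 lam_gt0. Qed.

(* Vertices in parts [>= 4] are isolated padding. *)
Definition part (v : nat) := v %/ m.
(** Blocks are residue classes, not intervals: as [p] divides [m], shifts by multiples of [m] keep
    the block index. *)
Definition idx (v : nat) := v %% p.

Definition part_adj (a b : nat) : bool :=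
  [|| (a < 2) && (b < 2), (a == 2) && (b == 3) | (a == 3) && (b == 2)].

(** Outer and inner parts alternate along the 4-cycle 0-1-3-2, so its edges are the pairs of parts
    on which [outer] differs. *)
Definition outer (a : nat) : bool := (a == 0) || (a == 3).

Definition special (h : nat * nat) (v : nat) : bool :=
  (part v < 4) && (idx v == if outer (part v) then h.1 else h.2).

Definition switched_pair (h : nat * nat) (u v : nat) : bool :=
  [&& special h u, special h v & outer (part u) != outer (part v)].

Definition switched_adj (h : nat * nat) : rel 'I_n := fun u v =>
  (u != v) && (part_adj (part u) (part v) (+) switched_pair h u v).

Lemma switched_adj_sym h : symmetric (switched_adj h).
Proof.
move=> u v; rewrite /switched_adj eq_sym; congr (_ && (_ (+) _)).
  by rewrite /part_adj; lia.
rewrite /switched_pair (eq_sym (outer _)).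
by case: (special h u); case: (special h v).
Qed.

Lemma switched_adj_irr h : irreflexive (switched_adj h).
Proof. by move=> u; rewrite /switched_adj eqxx. Qed.

Lemma mirror_subproof (v : nat) : (3 - part v) * m + v %% m < n.
Proof.
apply: leq_trans m4n; have := ltn_pmod v m_gt0.
have : (3 - part v) * m <= 3 * m by rewrite leq_mul2r leq_subr orbT.
lia.
Qed.

(* Exchanges parts 0 and 3, and parts 1 and 2, keeping the block index. *)
Definition mirror (v : 'I_n) : 'I_n := Ordinal (mirror_subproof v).

Lemma part_mirror (v : 'I_n) : part (mirror v) = 3 - part v.
Proof.
by rewrite /part /= divnMDl// [X in _ + X]divn_small ?addn0// ltn_pmod.
Qed.

Lemma idx_mirror (v : 'I_n) : idx (mirror v) = idx v.
Proof.
rewrite /idx /= {1}/m mulnA modnMDl modn_dvdm//.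
exact: dvdn_mull.
Qed.

Lemma mirrorK (v : 'I_n) : part v < 4 -> mirror (mirror v) = v.
Proof.
move=> v4; apply: val_inj; rewrite [LHS]/= -/(part (mirror v)) part_mirror.
by rewrite /= modnMDl modn_mod subKn// [RHS](divn_eq v m).
Qed.

(** Replaces a switched entry in the list of [u] by its mirror image in place, so the other slots
    keep their content. *)
Definition relist (h : nat * nat) (u v : 'I_n) : 'I_n :=
  if switched_pair h u v then mirror v else v.

Lemma outer_mirror (v : 'I_n) : part v < 4 -> outer (part (mirror v)) = outer (part v).
Proof. by rewrite part_mirror /outer; lia. Qed.

Lemma switched_pair_mirror h u (v : 'I_n) :
  switched_pair h u v -> switched_pair h u (mirror v).
Proof.
move=> /and3P[su /andP[v4 iv] uv].
rewrite /switched_pair su andTb /special outer_mirror// idx_mirror iv uv part_mirror.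
by rewrite !andbT; lia.
Qed.

Lemma relistK h u : involutive (relist h u).
Proof.
move=> v; rewrite /relist; case: (boolP (switched_pair h u v)) => [uv|].
  by rewrite switched_pair_mirror// mirrorK//; case/and3P: uv => _ /andP[].
by move/negPf->.
Qed.

Definition base_nbrs (u : 'I_n) : {pred 'I_n} :=
  [pred v | (u != v) && part_adj (part u) (part v)].

(** For a switched pair, [v] and its mirror image lie in the two parts next to that of [u] on the
    4-cycle, and [part_adj] joins exactly one of these to the part of [u]. *)
Lemma base_nbrs_relist h u v :
  (relist h u v \in base_nbrs u) = switched_adj h u v.
Proof.
rewrite /relist inE /switched_adj.
case: (boolP (switched_pair h u v)) => [/and3P[/andP[u4 _] /andP[v4 _] uv]|_].
  have -> : u != v by apply: contraNneq uv => ->.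
  have -> : u != mirror v.
    by apply: contraNneq uv => ->; rewrite outer_mirror.
  rewrite part_mirror; move: uv u4 v4; rewrite /outer /part_adj; clear; lia.
by rewrite addbF.
Qed.

Definition switched_list h (u : 'I_n) : seq 'I_n :=
  map (relist h u) (enum (base_nbrs u)).

Lemma switched_list_uniq h u : uniq (switched_list h u).
Proof. by rewrite map_inj_uniq ?enum_uniq//; apply: inv_inj; exact: relistK. Qed.

Lemma mem_switched_list h u v : (v \in switched_list h u) = switched_adj h u v.
Proof.
rewrite -{1}(relistK h u v) mem_map; last exact: inv_inj (relistK h u).
by rewrite mem_enum base_nbrs_relist.
Qed.

Definition switched_graph (h : nat * nat) : query_graph n :=
  QueryGraph (switched_adj_sym h) (switched_adj_irr h)
    (switched_list_uniq h) (mem_switched_list h).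

(* No block has index [p], so nothing is switched. *)
Let base := (p, p).

Lemma switched_pair_base u v : switched_pair base u v = false.
Proof.
apply/negP => /andP[/andP[_]]; rewrite if_same => /eqP uE _.
by have := ltn_pmod u p_gt0; rewrite [X in X < _]uE ltnn.
Qed.

(** * Each query detects at most one hidden pair *)

Definition pair_code (u v : nat) : nat * nat :=
  if outer (part u) then (idx u, idx v) else (idx v, idx u).

Lemma switched_pair_code h u v : switched_pair h u v -> h = pair_code u v.
Proof.
case: h => i j; rewrite /switched_pair /special /pair_code.
by case: (outer (part u)); case: (outer (part v)) => //= /and3P[
   /andP[_ /eqP->] /andP[_ /eqP->]].
Qed.

Definition hidden (h : 'I_p * 'I_p) : nat * nat := (val h.1, val h.2).

Lemma hidden_inj : injective hidden.
Proof. by move=> [i j] [i' j'] [/val_inj-> /val_inj->]. Qed.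

Lemma hidden_pair_code u v : exists h, hidden h = pair_code u v.
Proof.
pose i w : 'I_p := Ordinal (ltn_pmod w p_gt0).
exists (if outer (part u) then (i u, i v) else (i v, i u)).
by rewrite /pair_code /hidden; case: outer.
Qed.

Let G h := switched_graph (hidden h).
Let G0 := switched_graph base.

Lemma pair_query_detects_one u v :
  exists h0, forall h, h != h0 -> adj (G h) u v = adj G0 u v.
Proof.
have [h0 h0E] := hidden_pair_code u v; exists h0 => h hh0 /=.
rewrite /switched_adj switched_pair_base; congr (_ && (_ (+) _)).
by apply: contraNF hh0 => /switched_pair_code; rewrite -h0E => /hidden_inj->.
Qed.

Lemma nbr_query_detects_one u j :
  exists h0, forall h, h != h0 ->
    onth (adj_list (G h) u) j = onth (adj_list G0 u) j.
Proof.
have relist0 w : relist base u w = w by rewrite /relist switched_pair_base.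
case nbrE : (onth (enum (base_nbrs u)) j) => [w|]; last first.
  (* A slot past the end of the list is empty for every [h], so any [h0] serves. *)
  have [h0 _] := hidden_pair_code u u.
  by exists h0 => h _; rewrite /= /switched_list !onth_map nbrE.
have [h0 h0E] := hidden_pair_code u w; exists h0 => h hh0.
rewrite /= /switched_list !onth_map nbrE /= relist0 /relist.
case: ifPn => // /switched_pair_code; rewrite -h0E => /hidden_inj hE.
by rewrite hE eqxx in hh0.
Qed.

(** * Sizes of the clique, parts and blocks *)

Lemma card_clique : #|[pred v : 'I_n | part v < 2]| = 2 * m.
Proof.
apply: (@card_ord_injection _ _ _ id) => // [t|v]; first by move: m4n; lia.
rewrite inE /part ltn_divLR//.
by apply: (iffP idP) => [vm|[t tm ->]//]; exists v.
Qed.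

Lemma card_part a : a < 4 -> #|[pred v : 'I_n | part v == a]| = m.
Proof.
move=> a4; have am : a * m + m <= n.
  by apply: leq_trans m4n; rewrite -mulSnr leq_mul2r a4 orbT.
apply: (@card_ord_injection _ _ _ (fun t => a * m + t)) => [t|t t' _ _|v].
- by move: am; lia.
- exact: addnI.
rewrite inE; apply: (iffP eqP) => [va|[t tm ->]].
  by exists (v %% m); [rewrite ltn_pmod|rewrite -va -divn_eq].
by rewrite /part divnMDl// divn_small// addn0.
Qed.

Lemma card_block a i : a < 4 -> i < p ->
  #|[pred v : 'I_n | (part v == a) && (idx v == i)]| = lam.
Proof.
move=> a4 ip; have am : a * m + m <= n.
  by apply: leq_trans m4n; rewrite -mulSnr leq_mul2r a4 orbT.
have tip t : t < lam -> t * p + i < m.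
  move=> tl; rewrite /m; apply: (@leq_trans (t.+1 * p)).
    by rewrite mulSnr ltn_add2l.
  by rewrite leq_mul2r tl orbT.
apply: (@card_ord_injection _ _ _ (fun t => a * m + (t * p + i))) =>
  [t /tip|t t' _ _|v].
- by move: am; lia.
- move/addnI/addIn/eqP; rewrite eqn_pmul2r//; exact: eqP.
rewrite inE; apply: (iffP andP) => [[/eqP va /eqP vi]|[t tl ->]].
  exists ((v %% m) %/ p); first by rewrite ltn_divLR// ltn_pmod.
  have -> : i = (v %% m) %% p by rewrite modn_dvdm ?dvdn_mull.
  by rewrite -divn_eq -va -divn_eq.
rewrite /part /idx divnMDl// divn_small ?tip// addn0 eqxx.
by rewrite {1}/m mulnA !modnMDl modn_small.
Qed.

(** * Degeneracy and colorings of the switched graphs *)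

Let kappa := 2 * m - lam.+1.

Let lam2m : lam + lam <= m.
Proof. by rewrite /m addnn -muln2 leq_mul2l p_gt1 orbT. Qed.

Lemma switched_degenerate h : degenerate (switched_graph (hidden h)) kappa.
Proof.
case: h => i j; set H := hidden _.
apply/forallP => S; apply/implyP => /finset.set0Pn[v0 v0S].
pose clique := [pred v : 'I_n | part v < 2].
pose B a k := [pred v : 'I_n | (part v == a) && (idx v == k)].
(* A vertex of [S] outside the clique has degree at most [m], since switching preserves degrees. *)
have [/existsP[v /andP[vS v2]]|/existsPn Spart] :=
    boolP [exists v : 'I_n, (v \in S) && (2 <= part v)].
  apply/existsP; exists v; rewrite vS /induced_degree /=.
  apply: (@leq_trans #|switched_list H v|).
    apply: subset_leq_card; apply/fintype.subsetP => w; rewrite !inE => /andP[_].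
    by rewrite mem_switched_list.
  rewrite (card_uniqP (switched_list_uniq H v)) size_map -cardE.
  apply: (@leq_trans m); last by rewrite /kappa; lia.
  (* [5 - part v] exchanges parts 2 and 3; a padding vertex has an empty list, so any part bounds
     it. *)
  rewrite -(@card_part (5 - part v)); last lia.
  apply: subset_leq_card; apply/fintype.subsetP => w; rewrite !inE /part_adj.
  by move: v2; lia.
have Sclique w : w \in S -> part w < 2.
  by move=> wS; have := Spart w; rewrite wS -ltnNge.
(* A vertex of block [i] in part 0 has lost its [lam] clique neighbors in block [j] of part 1. *)
have [/existsP[v /andP[vS vB]]|/existsPn SB] :=
    boolP [exists v : 'I_n, (v \in S) && (v \in B 0 i)].
  apply/existsP; exists v; rewrite vS /induced_degree /=.
  move: vB; rewrite inE => /andP[/eqP pv /eqP iv].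
  have vcl : v \in clique by rewrite inE pv.
  have sub : B 1 j \subset [predD1 clique & v].
    apply/fintype.subsetP => w; rewrite !inE => /andP[/eqP pw _].
    rewrite pw andbT; apply/eqP => wv.
    by rewrite wv pv in pw.
  have -> : kappa = #|[predD [predD1 clique & v] & B 1 j]|.
    rewrite (card_predD sub) card_block// /kappa -card_clique.
    rewrite (cardD1 v clique) vcl.
    by rewrite add1n subSS.
  apply: subset_leq_card; apply/fintype.subsetP => w.
  rewrite !inE => /andP[/Sclique pw /andP[vw]].
  rewrite pw [w == v]eq_sym vw !andbT /switched_pair /special pv /= iv eqxx /=.
  by move=> vwN; apply: contraTN vwN => /andP[/eqP-> /=/eqP->]; rewrite eqxx.
(* Now [S] avoids that block, so it has at most [2 * m - lam] vertices and any of them serves. *)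
apply/existsP; exists v0; rewrite v0S /induced_degree /=.
have sub : B 0 i \subset clique.
  by apply/fintype.subsetP => w; rewrite !inE => /andP[/eqP->].
have := card_predD sub; rewrite card_clique (@card_block 0)// => cD.
have : #|S| <= 2 * m - lam.
  rewrite -cD; apply: subset_leq_card; apply/fintype.subsetP => w wS.
  by have := SB w; rewrite !inE wS /= => ->; exact: Sclique.
rewrite (cardD1 v0 S) v0S => Sle.
apply: (@leq_trans #|[predD1 S & v0]|); last by rewrite /kappa; move: Sle; lia.
apply: subset_leq_card; apply/fintype.subsetP => w; rewrite !inE => /andP[-> /andP[+ _]].
by rewrite eq_sym => ->.
Qed.

(** The clique without block [i] of part 0 stays complete, since every switched pair inside the
    clique meets this block. *)
Lemma switched_degenerate_ge h k :
  degenerate (switched_graph (hidden h)) k -> kappa <= k.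
Proof.
case: h => i j /forallP.
pose clique := [pred v : 'I_n | part v < 2].
pose B := [pred v : 'I_n | (part v == 0) && (idx v == i)].
pose S := [set v : 'I_n | (v \in clique) && (v \notin B)].
have cS : #|S| = 2 * m - lam.
  rewrite -card_clique -(@card_block 0 i)// -card_predD; last first.
    by apply/fintype.subsetP => w; rewrite !inE => /andP[/eqP->].
  by rewrite finset.cardsE; apply: eq_card => v; rewrite !inE andbC.
move=> /(_ S)/implyP SP; have /SP/existsP[v /andP[vS]] : S != finset.set0.
  by rewrite -finset.cards_eq0 cS; move: lam2m m_gt0; lia.
apply: leq_trans.
have -> : kappa = #|[predD1 S & v]|.
  by rewrite /kappa subnS -cS (cardD1 v) vS.
apply: subset_leq_card; apply/fintype.subsetP => w.
move: vS; rewrite !inE => /andP[v2 vB] /and3P[wv w2 wB].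
rewrite w2 wB /= /switched_adj [v == w]eq_sym wv /=.
have -> : part_adj (part v) (part w) by rewrite /part_adj v2 w2.
rewrite addTb; apply/negP => /and3P[/andP[_ iv] /andP[_ iw] vw].
move: v2 w2 vB wB iv iw vw; rewrite /outer.
by case: (part v) => [|[|?]] //=; case: (part w) => [|[|?]] //= _ _;
  case: (_ == _); case: (_ == _).
Qed.

Lemma degeneracy_switched h : degeneracy (switched_graph (hidden h)) = kappa.
Proof.
rewrite /degeneracy; case: ex_minnP => k /switched_degenerate_ge kk.
by move=> /(_ _ (switched_degenerate h)) kk'; apply/eqP; rewrite eqn_leq kk' kk.
Qed.

(* The [2 m] clique vertices get at most [2 m - 1] colors; a monochromatic pair
   of them must be switched, and it determines [h]. *)
Lemma proper_coloring_determines (c : {ffun 'I_n -> nat}) :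
  exists h0, forall h, proper_coloring (kappa + lam) (G h) c -> h = h0.
Proof.
have [hc|nhc] := pselect (exists h, proper_coloring (kappa + lam) (G h) c);
  last first.
  have [h0 _] := hidden_pair_code 0 0; exists h0 => h hc.
  by case: nhc; exists h.
case: hc => h1 [c_lt _].
pose f v : 'I_(kappa + lam) := Ordinal (c_lt v).
have : ~~ dinjectiveb f [pred v : 'I_n | part v < 2].
  apply/negP => /dinjectiveP/leq_card_in; rewrite card_clique card_ord /kappa.
  by move: lam2m lam_gt0; lia.
case/dinjectivePn => u u2 [v /andP[vu v2] fuv].
have [h0 h0E] := hidden_pair_code u v.
exists h0 => h [_ c_proper]; apply: hidden_inj; rewrite h0E.
apply: switched_pair_code; apply: contraT => huv.
have := c_proper u v; rewrite /= /switched_adj eq_sym vu (negPf huv) addbF /=.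
rewrite !inE in u2 v2; rewrite /part_adj u2 v2 => /(_ isT) /negP[].
by apply/eqP; exact: (congr1 val fuv).
Qed.

(** Undetected hidden pairs all get the output on [G0], a single coloring, which is proper for at
    most one of them; hence the extra 1. *)
Lemma few_switched_successes (t : query_tree n {ffun 'I_n -> nat}) (Q : nat) :
  exists s : seq ('I_p * 'I_p), size s <= Q.+1 /\
    forall h, proper_coloring (kappa + lam) (G h) (run (G h) t) ->
      num_queries (G h) t <= Q -> h \in s.
Proof.
have [s [sQ sP]] :=
  query_indistinguishable pair_query_detects_one nbr_query_detects_one Q t.
have [h0 h0P] := proper_coloring_determines (run G0 t).
exists (h0 :: s); split=> // h + hQ; rewrite inE.
have [//|hs] := boolP (h \in s); first by rewrite orbT.
by rewrite sP// => /h0P->; rewrite eqxx.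
Qed.

End SwitchedGraph.

(** * Averaging over the hidden pairs *)

Local Open Scope classical_set_scope.
Local Open Scope ring_scope.

(** The sum is the expected number of events that occur, and this number never exceeds [M]. *)
Lemma sum_probability_le (R : realType) (d : measure_display)
    (T : measurableType d) (P : probability T R) (I : finType)
    (E : I -> set T) (M : nat) :
  (forall i, measurable (E i)) ->
  (forall r, exists s : seq I, (size s <= M)%N /\ forall i, E i r -> i \in s) ->
  (\sum_i P (E i) <= M%:R%:E)%E.
Proof.
move=> mE EM.
have mf i : measurable_fun [set: T] (EFin \o (\1_(E i) : T -> R)).
  by apply/measurable_EFinP; exact: measurable_indic.
have -> : (\sum_i P (E i) =
    \int[P]_r (\sum_(i <- index_enum I) (\1_(E i) r : R)%:E))%E.
  rewrite ge0_integral_sum//.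
  by apply: eq_bigr => i _; rewrite integral_indic// setIT.
apply: (@le_trans _ _ (\int[P]_r (M%:R : R)%:E)%E); last first.
  by rewrite integral_cst//= probability_setT mule1.
apply: ge0_le_integral => //.
- by move=> r _; apply: sume_ge0.
- exact: emeasurable_sum.
move=> r _; have [s [sM Es]] := EM r.
rewrite sumEFin lee_fin (eq_bigr (fun i => ((r \in E i) : nat)%:R)); last first.
  by move=> i _; rewrite indicE.
rewrite -natr_sum ler_nat (leq_trans _ sM)//.
apply: leq_trans (card_size s); rewrite -sum1_card [X in (_ <= X)%N]big_mkcond /=.
apply: leq_sum => i _; case: ifPn => [_|/negP his]; first exact: leq_b1.
by rewrite leqn0 eqb0; apply/negP => /set_mem/Es.
Qed.

Theorem theorem5p14 (R : realType) :
  exists (c : R) (C : nat), 0 < c /\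
  forall lambda n : nat, (1 <= lambda)%N -> (C * lambda <= n)%N ->
  forall (d : measure_display) (T : measurableType d) (P : probability T R)
    (A : nat -> rand_query_alg T n {ffun 'I_n -> nat}),
  (forall (kappa : nat) (G : query_graph n), degeneracy G = kappa ->
     ((2 / 3)%R%:E <=
        P [set r | proper_coloring (kappa + lambda)%N G (run G (A kappa r))])%E) ->
  exists (kappa : nat) (G : query_graph n), degeneracy G = kappa /\
    (0 < P [set r | (c * (n%:R ^+ 2 / lambda%:R ^+ 2)
                       <= (num_queries G (A kappa r))%:R)%R])%E.
Proof.
(* The 8 forces [p >= 2]; as [n / lambda <= 6 p], the factor [1/144] gives [X <= p^2 / 4]. *)
exists 144^-1, 8%N; split=> // lambda n lam_gt0 lam8n d T P A A_ok.
set c : R := 144^-1; set X := c * _.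
pose p := ((n %/ lambda) %/ 4)%N.
have p_gt1 : (1 < p)%N by rewrite !leq_divRL//; lia.
have m4n : (4 * (lambda * p) <= n)%N.
  rewrite mulnCA mulnC; apply: leq_trans (leq_trunc_div n lambda).
  by rewrite leq_mul2r mulnC leq_trunc_div orbT.
(* Undoing both floors gives [n <= (4 p + 4) lambda], and [p >= 2]. *)
have n6 : (n <= 6 * p * lambda)%N.
  have := ltn_ceil n lam_gt0; have := ltn_ceil (n %/ lambda) (isT : (0 < 4)%N).
  by rewrite -/p; nia.
pose Q := (p * p %/ 4)%N.
have XQ (q : nat) : ~~ (X <= q%:R) -> (q <= Q)%N.
  rewrite -ltNge => qX; rewrite leq_divRL// -(ler_nat R) !natrM.
  have l0 : (0 : R) < lambda%:R by rewrite ltr0n.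
  have : n%:R / lambda%:R <= 6 * p%:R :> R.
    by rewrite ler_pdivrMr// -!natrM ler_nat.
  have : 0 <= n%:R / lambda%:R :> R by rewrite divr_ge0.
  move: qX; rewrite /X /c -expr_div_n; set y := _ / _ => qX y0 y6.
  have : y ^+ 2 <= 36 * (p%:R * p%:R) by nra.
  lra.
pose G h := switched_graph lam_gt0 p_gt1 m4n (@hidden p h).
(* All hidden pairs share this degeneracy, so the same [A kappa] faces them all. *)
pose kappa := (2 * (lambda * p) - lambda.+1)%N.
(* Otherwise [X] queries are reached with probability zero on every [G h], so success with fewer
   queries still has probability at least [2/3]. *)
apply: contrapT => no_graph.
pose good h := [set r |
  proper_coloring (kappa + lambda) (G h) (run (G h) (A kappa r))].
pose long h := [set r | X <= (num_queries (G h) (A kappa r))%:R].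
have Pgood h : ((2 / 3)%:E <= P (good h `\` long h))%E.
  have mgood : measurable (good h) by exact: (measurable_run (A kappa) (G h)).
  have mlong : measurable (long h).
    exact: (measurable_num_queries (A kappa) (G h) [set q | X <= q%:R]).
  have Plong : P (long h) = 0.
    apply/eqP; rewrite -measure_le0 leNgt; apply/negP => Plong.
    apply: no_graph; exists kappa, (G h); split=> //.
    exact: degeneracy_switched.
  apply: le_trans (A_ok kappa (G h) (degeneracy_switched _ _ _ h)) _.
  rewrite -/(good h) (measureDI _ mgood mlong).
  rewrite (subset_measure0 _ mlong (@subIsetr _ _ _) Plong) ?adde0//.
  exact: measurableI.
have : (\sum_(h : 'I_p * 'I_p) P (good h `\` long h) <= Q.+1%:R%:E)%E.
  apply: sum_probability_le => [h|r].
    by apply: measurableD; [exact: (measurable_run (A kappa) (G h))|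
      exact: (measurable_num_queries (A kappa) (G h) [set q | X <= q%:R])].
  have [s [sQ sP]] := few_switched_successes lam_gt0 p_gt1 m4n (A kappa r) Q.
  by exists s; split=> // h [ok /negP short]; apply: sP => //; exact: XQ.
apply/negP; rewrite -ltNge.
apply: (@lt_le_trans _ _ (\sum_(h : 'I_p * 'I_p) (2 / 3 : R)%:E)%E);
  last first.
  by apply: lee_sum => h _; exact: Pgood.
(* It remains that [(2/3) p^2 > p^2 / 4 + 1 >= Q + 1], which holds for [p >= 2]. *)
rewrite sumEFin sumr_const card_prod card_ord lte_fin -[ltRHS]mulr_natr natrM.
have := leq_trunc_div (p * p) 4; rewrite -/Q -(ler_nat R) !natrM -natr1.
have : 2 <= p%:R :> R by rewrite ler_nat.
nra.
Qed.
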